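(* Let $x=(x_1,\dots,x_N)\in\mathbb{R}^N$ and let $\epsilon\in\mathbb{R}$ satisfy $\epsilon+\mathrm{Var}[x]>0$. Let $y=(y_1,\dots,y_N)$ be the output of the LayerNorm map $$y_i=\frac{x_i-\mathbb{E}[x]}{\sqrt{\epsilon+\mathrm{Var}[x]}},\qquad i=1,\dots,N,$$ and let $f$ be a real-valued function of $y$, differentiable at this $y$, and regarded through the LayerNorm map as a function of $x$. Then the Gradient$\times$Input relevances satisfy $$\sum_{i=1}^N\mathcal{R}(x_i)=\Big(1-\frac{\mathrm{Var}[x]}{\epsilon+\mathrm{Var}[x]}\Big)\sum_{i=1}^N\mathcal{R}(y_i).$$
   Context: $\mathbb{E}$ and $\mathrm{Var}$ are with respect to the uniform distribution on the $N$ entries: $\mathbb{E}[x]=\frac1N\sum_i x_i$ and $\mathrm{Var}[x]=\frac1N\sum_i (x_i-\mathbb{E}[x])^2$. These quantities depend on $x$ and are differentiated through. Gradient$\times$Input relevances: $\mathcal{R}(x_i)=x_i\,\frac{\partial f}{\partial x_i}$, where the derivative is that of the composition of $f$ with the LayerNorm map at $x$, and $\mathcal{R}(y_i)=y_i\,\frac{\partial f}{\partial y_i}$, where the derivative is that of $f$ with respect to its argument $y_i$. *)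

(* Defs.v *)
From HB Require Import structures.
From mathcomp Require Import all_boot all_order all_algebra.
From mathcomp Require Import all_classical all_reals all_analysis.

Set Implicit Arguments.
Unset Strict Implicit.
Unset Printing Implicit Defensive.

Import Order.TTheory GRing.Theory Num.Theory.
Import numFieldNormedType.Exports.

Local Open Scope ring_scope.

Definition entry_mean (R : realType) (N : nat) (x : 'rV[R]_N) : R :=
  N%:R^-1 * \sum_(i < N) x 0 i.

Definition entry_var (R : realType) (N : nat) (x : 'rV[R]_N) : R :=
  N%:R^-1 * \sum_(i < N) (x 0 i - entry_mean x) ^+ 2.

Definition layernorm (R : realType) (N : nat) (eps : R) (x : 'rV[R]_N) :
    'rV[R]_N :=
  \row_(i < N) ((x 0 i - entry_mean x) / Num.sqrt (eps + entry_var x)).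

(* The i-th partial derivative is the derivative along the i-th vector
   [delta_mx 0 i] of the canonical basis. [derive] is total; its value is
   meaningful when [g] is derivable at [z] in that direction. *)
Definition partial_derivative (R : realType) (N : nat) (g : 'rV[R]_N -> R)
    (z : 'rV[R]_N) (i : 'I_N) : R :=
  'D_(delta_mx 0 i) g z.

Definition relevance (R : realType) (N : nat) (g : 'rV[R]_N -> R)
    (z : 'rV[R]_N) (i : 'I_N) : R :=
  z 0 i * partial_derivative g z i.

(* Main.v *)
(* LayerNorm is [x |-> (eps + Var x)^(-1/2) * (x - E x)], where the centering
   is linear and [Var] is homogeneous of degree 2. By the chain rule the sum
   of the input relevances is the differential of [f], at [layernorm x],
   applied to the radial derivative of LayerNorm at [x]; by Euler's identity
   that derivative is [(1 - Var x / (eps + Var x)) *: layernorm x]. *)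
From HB Require Import structures.
Require Import Defs.
From mathcomp Require Import all_boot all_order all_algebra.
From mathcomp Require Import all_classical all_reals all_analysis.
From mathcomp Require Import ring.
Import Order.TTheory GRing.Theory Num.Theory.
Import numFieldNormedType.Exports.
Local Open Scope ring_scope.

Lemma is_diff_sum (R : realType) (V W : normedModType R) (n : nat)
    (f df : 'I_n -> V -> W) (x : V) :
  (forall i, is_diff x (f i) (df i)) ->
  is_diff x (\sum_(i < n) f i) (\sum_(i < n) df i).
Proof.
move=> fdf; elim/big_ind2 : _ => // [|? ? ? ? ? ?].
- exact: is_diff_cst.
- exact: is_diffD.
Qed.

Lemma is_diff_coord (R : realType) (m n : nat) (M : 'M[R]_(m, n)) i j :
  is_diff M (fun A : 'M[R]_(m, n) => A i j) (fun A => A i j).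
Proof.
apply: DiffDef; first exact: differentiable_coord.
have cl : linear (fun A : 'M[R]_(m, n) => A i j) by move=> a A B; rewrite !mxE.
pose cL := GRing.isLinear.Build R _ R _ (fun A : 'M[R]_(m, n) => A i j) cl.
(* Packing the coordinate map as a linear one lets [diff_lin] identify it with its own differential,
   by continuity. *)
pose c : {linear 'M[R]_(m, n) -> R} := HB.pack (fun A : 'M[R]_(m, n) => A i j) cL.
by rewrite (_ : (fun A => _) = c)// diff_lin//; exact: coord_continuous.
Qed.

Lemma is_diff_scalel_comp (R : realType) (V W : normedModType R)
    (k dk : V -> R) (w : W) (x : V) :
  is_diff x k dk -> is_diff x (fun z => k z *: w) (fun z => dk z *: w).
Proof.
move=> kdk; apply: DiffDef; first exact: differentiableZl.
by rewrite diffZl// diff_val.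
Qed.

Lemma is_diff_entry_mean (R : realType) (N : nat) (x : 'rV[R]_N) :
  is_diff x (@entry_mean R N) (@entry_mean R N).
Proof.
have -> : @entry_mean R N = N%:R^-1 *: \sum_(i < N) (fun z : 'rV[R]_N => z 0 i).
  by apply/funext => z; rewrite /entry_mean fctE fct_sumE.
by apply: is_diffZ; apply: is_diff_sum => i; exact: is_diff_coord.
Qed.

Lemma is_diff_centered_coord (R : realType) (N : nat) (x : 'rV[R]_N) i :
  is_diff x (fun z : 'rV[R]_N => z 0 i - entry_mean z)
    (fun z : 'rV[R]_N => z 0 i - entry_mean z).
Proof.
exact: (is_diffB (is_diff_coord _ _ _ x 0 i) (is_diff_entry_mean _ _ x)).
Qed.

(** The chain rule applies to each squared deviation. Keeping [h 0 i - entry_mean h] unexpanded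
    makes [h = x] turn the sum directly into [2 * entry_var x]. *)
Lemma is_diff_entry_var (R : realType) (N : nat) (x : 'rV[R]_N) :
  is_diff x (@entry_var R N) (fun h => N%:R^-1 *
    \sum_(i < N) 2 * (x 0 i - entry_mean x) * (h 0 i - entry_mean h)).
Proof.
pose c i := fun z : 'rV[R]_N => z 0 i - entry_mean z.
have -> : @entry_var R N = N%:R^-1 *: \sum_(i < N) c i ^+ 2.
  by apply/funext => z; rewrite /entry_var fctE fct_sumE.
have dc2 i := is_diffX 1 (is_diff_centered_coord R N x i).
have := @is_diffZ _ _ _ _ _ N%:R^-1 x
  (@is_diff_sum R _ _ N (fun i => c i ^+ 2) _ x dc2).
by move/is_diff_eq; apply; apply/funext => h; rewrite fctE fct_sumE.
Qed.

Lemma is_diff_inv_sqrt (R : realType) (V : normedModType R) (g dg : V -> R)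
    (x : V) : 0 < g x -> is_diff x g dg ->
  is_diff x (fun z => (Num.sqrt (g z))^-1)
    (fun h => - (2 * g x * Num.sqrt (g x))^-1 * dg h).
Proof.
move=> g0 gdg.
have s0 : Num.sqrt (g x) != 0 by rewrite gt_eqF// sqrtr_gt0.
have ds : differentiable (@Num.sqrt R) (g x).
  exact/derivable1_diffP/(@ex_derive _ _ _ _ _ _ _ (is_derive1_sqrt g0)).
have dsg : differentiable (Num.sqrt \o g) x by apply: differentiable_comp.
apply: DiffDef; first exact: (differentiableV dsg).
rewrite (diffV dsg)// diff_comp// diff_val; apply/funext => h /=.
(* Writing [dg h] as a multiple of [1] reduces the differential of the square root to its ordinary
   derivative. *)
rewrite -[dg h]mulr1 -[dg h * 1]/(dg h *: (1 : R)) linearZ/= -deriveE//.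
rewrite derive_sqrt// -[X in 2 * X * _](sqr_sqrtr (ltW g0)) /GRing.scale/=.
by field.
Qed.

(** In the product rule along [x], the linear centering reproduces [layernorm eps x], which gives
    the [1]; the inverse square root gives the correction [- entry_var x / (eps + entry_var x)]. *)
Lemma diff_layernorm_radial (R : realType) (N : nat) (x : 'rV[R]_N)
    (eps : R) : 0 < eps + entry_var x ->
  differentiable (layernorm eps) x /\
  'd (layernorm eps) x x =
    (1 - entry_var x / (eps + entry_var x)) *: layernorm eps x.
Proof.
move=> e0.
have dv : is_diff x (fun z : 'rV[R]_N => eps + entry_var z) _ :=
  is_diff_eq (is_diffD (is_diff_cst eps x) (is_diff_entry_var R N x)) (add0r _).
have dr := is_diff_inv_sqrt _ _ (fun z => eps + entry_var z) _ _ e0 dv.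
(* Expanding the output row in the basis [delta_mx 0 i] reduces the vector-valued map to scalar
   products. *)
have dL := @is_diff_sum R _ _ N _ _ x (fun i => is_diff_scalel_comp _ _ _ _ _
  (delta_mx 0 i : 'rV[R]_N) x (is_diffM (is_diff_centered_coord R N x i) dr)).
set F := (X in is_diff x X _) in dL.
have LE : layernorm eps = F.
  apply/funext => z; rewrite /F fct_sumE [LHS]row_sum_delta.
  by apply: eq_bigr => i _; rewrite mxE.
rewrite -LE in dL.
case: dL => dL dLE; split=> //.
rewrite dLE fct_sumE [layernorm eps x]row_sum_delta scaler_sumr.
apply: eq_bigr => i _; rewrite [RHS]scalerA !mxE; congr (_ *: _).
rewrite !fctE.
have -> : N%:R^-1 * \sum_(j < N) 2 * (x 0 j - entry_mean x) *
    (x 0 j - entry_mean x) = 2 * entry_var x.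
  rewrite /entry_var mulrCA; congr (_ * _); rewrite mulr_sumr.
  by apply: eq_bigr => j _; rewrite expr2 mulrA.
have s0 : Num.sqrt (eps + entry_var x) != 0 by rewrite gt_eqF// sqrtr_gt0.
(* With [c] the centered entry, [v] the variance and [s] the root of [eps + v], this is [c / s - c *
   (2 * v) / (2 * (eps + v) * s) = (1 - v / (eps + v)) * (c / s)]. *)
rewrite /GRing.scale/=; field.
by rewrite s0 gt_eqF.
Qed.

(** The relevances are the terms obtained by expanding [z] in the canonical basis inside the linear
    map ['d g z]. *)
Lemma sum_relevance (R : realType) (N : nat) (g : 'rV[R]_N -> R)
    (z : 'rV[R]_N) : differentiable g z ->
  \sum_(i < N) relevance g z i = 'd g z z.
Proof.
move=> dg; rewrite [X in 'd g z X]row_sum_delta linear_sum.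
apply: eq_bigr => i _.
by rewrite linearZ/= -deriveE.
Qed.

Theorem proposition3p2 (R : realType) (N : nat) (x : 'rV[R]_N) (eps : R)
  (f : 'rV[R]_N -> R)
  (Heps : 0 < eps + entry_var x)
  (Hf : differentiable f (layernorm eps x)) :
  \sum_(i < N) relevance (f \o layernorm eps) x i =
  (1 - entry_var x / (eps + entry_var x)) *
    \sum_(i < N) relevance f (layernorm eps x) i.
Proof.
have [dL radial] := diff_layernorm_radial _ _ _ _ Heps.
(* Both sums become radial differentials, of the composition at [x] and of [f] at [layernorm eps x];
   linearity of the latter then extracts the factor. *)
rewrite !sum_relevance//; last exact: differentiable_comp.
by rewrite diff_comp//= radial linearZ.
Qed.
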